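(* Let $\mathbb{F}_q$ be a finite field with $\operatorname{char}(\mathbb{F}_q)\neq 2$. Let $a,b\in\mathbb{F}_q$ be such that $x^2-ax+b$ is irreducible in $\mathbb{F}_q[x]$, let $\Delta:=a^2-4b$, and let $A_3=\begin{pmatrix}0&-b\\1&a\end{pmatrix}$. If $\Delta=-b$, then $|\mathcal{D}_{A_3}(\mathbb{F}_q)|=2$, where $\mathcal{D}_{A_3}(\mathbb{F}_q)=\{X\in M_2(\mathbb{F}_q)\mid XA_3X=A_3XA_3\}$.
   Context: $M_2(\mathbb{F}_q)$ is the space of $2\times 2$ matrices over $\mathbb{F}_q$. *)

(* Defs.v *)
From HB Require Import structures.
From mathcomp Require Import all_boot all_order all_algebra.

Set Implicit Arguments.
Unset Strict Implicit.
Unset Printing Implicit Defensive.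

Import GRing.Theory.
Local Open Scope ring_scope.

Definition Delta (F : fieldType) (a b : F) : F := a ^+ 2 - 4%:R * b.

Definition A3 (F : fieldType) (a b : F) : 'M[F]_2 :=
  \matrix_(i < 2, j < 2)
    nth 0 (nth [::] [:: [:: 0; - b];
                        [:: 1;   a]] i) j.

Definition DA (F : finFieldType) (A : 'M[F]_2) : {set 'M[F]_2} :=
  [set X : 'M[F]_2 | X *m A *m X == A *m X *m A].

(* Main.v *)
Require Import Defs.
From HB Require Import structures.
From mathcomp Require Import all_boot all_order all_algebra.
From mathcomp Require Import ring.

Set Implicit Arguments.
Unset Strict Implicit.
Unset Printing Implicit Defensive.

Import GRing.Theory.
Local Open Scope ring_scope.

(** For [2 x 2] matrices, Cayley-Hamilton turns [X A X = A X A] into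
    [(e - b) X + (d - e) A + (b t - d a) = 0] with [t = tr X], [d = det X],
    [e = tr (X A)].  Up to sign, [det (X A - A X)] is the value [N] at some
    [(u, v)] of the norm form [u^2 + a u v + b v^2] of [F[A]], which is
    anisotropic by irreducibility, and [u = v = 0] means that [X] lies in the
    field [F[A]].  If [X] does not commute with [A], then [e = b], whence
    [d = b] and [t = a], and
    [N = t^2 b + a^2 d + e^2 - t a e - 4 d b = b (a^2 - 3 b) = 0],
    a contradiction.  If it does, then [X A (X - A) = 0] in the field [F[A]],
    so [X] is [0] or [A]. *)

Lemma mulmx2E (R : pzSemiRingType) (A B : 'M[R]_2) i j :
  (A *m B) i j = A i 0 * B 0 j + A i 1 * B 1 j.
Proof.
rewrite mxE big_ord_recl big_ord1.
by rewrite (_ : lift ord0 ord0 = 1) //; apply: val_inj.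
Qed.

Lemma matrix2P (R : Type) (A B : 'M[R]_2) :
  [/\ A 0 0 = B 0 0, A 0 1 = B 0 1, A 1 0 = B 1 0 & A 1 1 = B 1 1] -> A = B.
Proof.
case=> e00 e01 e10 e11; apply/matrixP.
have ord2 (i : 'I_2) : i = 0 \/ i = 1.
  by case: i => [[|[|//]] lti]; [left | right]; apply: val_inj.
by move=> i j; case: (ord2 i) => ->; case: (ord2 j) => ->.
Qed.

Section AnisotropicNormForm.

Variables (F : fieldType) (a b : F).

(** A root [r] would give the divisor ['X - r%:P] of size 2, while a divisor of size other than 1
    must have the full size 3. *)
Lemma irreducible_quadratic_neq0 (r : F) :
  irreducible_poly ('X^2 - a *: 'X + b%:P) -> r ^+ 2 - a * r + b != 0.
Proof.
move=> irr; apply/eqP=> r0; case: irr => sz_gt1 irr.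
have size_p : size ('X^2 - a *: 'X + b%:P) = 3%N.
  rewrite -addrA size_polyDl size_polyXn // (leq_ltn_trans (size_polyD _ _)) //.
  rewrite gtn_max size_polyN (leq_ltn_trans (size_scale_leq _ _)) ?size_polyX //.
  by rewrite (leq_ltn_trans (size_polyC_leq1 _)).
have sz_lin : size ('X - r%:P) != 1%N by rewrite size_XsubC.
have /(irr _ sz_lin)/eqp_size : 'X - r%:P %| 'X^2 - a *: 'X + b%:P.
  by rewrite dvdp_XsubCl rootE !hornerE r0.
by rewrite size_XsubC size_p.
Qed.

Hypothesis irr : irreducible_poly ('X^2 - a *: 'X + b%:P).

Lemma irreducible_const_neq0 : b != 0.
Proof.
by have := irreducible_quadratic_neq0 0 irr; rewrite expr0n mulr0 subr0 add0r.
Qed.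

(** If [v] is nonzero, dividing by [v ^+ 2] makes [- u / v] a root of the irreducible quadratic. *)
Lemma norm_form_anisotropic (u v : F) :
  u ^+ 2 + a * u * v + b * v ^+ 2 = 0 -> u = 0 /\ v = 0.
Proof.
move=> N0; have [v0|v_neq0] := eqVneq v 0.
  split=> //; apply/eqP; rewrite -sqrf_eq0 -N0 v0; apply/eqP; ring.
have /eqP[] := irreducible_quadratic_neq0 (- u / v) irr.
rewrite -[RHS](mul0r (v ^- 2)) -N0; field.
exact: v_neq0.
Qed.

Lemma A3_braid_eq0_or_A3 (X : 'M[F]_2) : Delta a b = - b ->
  X *m A3 a b *m X = A3 a b *m X *m A3 a b -> X = 0 \/ X = A3 a b.
Proof.
rewrite /Delta => hDelta /matrixP XAX.
have a2 : a ^+ 2 = 3%:R * b.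
  by apply/eqP; rewrite -subr_eq0 -(subrr (- b)) -{1}hDelta; apply/eqP; ring.
have b_neq0 := irreducible_const_neq0.
have := XAX 0 0; have := XAX 0 1; have := XAX 1 0; have := XAX 1 1.
rewrite !mulmx2E !mxE /= => {XAX}.
set x := X 0 0; set y := X 0 1; set z := X 1 0; set w := X 1 1.
move=> /eqP; rewrite -subr_eq0 => /eqP E11.
move=> /eqP; rewrite -subr_eq0 => /eqP E10.
move=> /eqP; rewrite -subr_eq0 => /eqP E01.
move=> /eqP; rewrite -subr_eq0 => /eqP E00.
pose t := x + w; pose d := x * w - y * z; pose e := y - b * z + a * w.
(* The four equations become the entries of the Cayley-Hamilton form of the relation. *)
have {}E11 : (e - b) * w + (d - e) * a + b * t - d * a = 0.
  by rewrite -[RHS]E11 /t /d /e; ring.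
have {}E10 : (e - b) * z + (d - e) = 0 by rewrite -[RHS]E10 /t /d /e; ring.
have {}E01 : (e - b) * y - b * (d - e) = 0.
  by rewrite -[RHS]E01 /t /d /e; ring.
have {}E00 : (e - b) * x + b * t - d * a = 0.
  by rewrite -[RHS]E00 /t /d /e; ring.
(* As linear forms in [X], [u] and [v] vanish on the identity and on [A], so applied to that
   relation they leave only the multiples by [e - b]. *)
pose u := y + b * z; pose v := w - x - a * z.
have Eu : (e - b) * u = 0.
  transitivity (((e - b) * y - b * (d - e)) + b * ((e - b) * z + (d - e))).
    by rewrite /u; ring.
  by rewrite E01 E10; ring.
have Ev : (e - b) * v = 0.
  transitivity (((e - b) * w + (d - e) * a + b * t - d * a)
    - ((e - b) * x + b * t - d * a) - a * ((e - b) * z + (d - e))).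
    by rewrite /v; ring.
  by rewrite E11 E00 E10; ring.
have [u0 v0] : u = 0 /\ v = 0.
  have [eb|eb] := eqVneq (e - b) 0; last first.
    by split; apply: (mulfI eb); rewrite mulr0.
  have e_b : e = b by apply/eqP; rewrite -subr_eq0 eb.
  have d_b : d = b.
    by move: E10; rewrite e_b => E; apply/eqP; rewrite -subr_eq0 -E; apply/eqP; ring.
  have t_a : t = a.
    move: E00; rewrite e_b d_b => E; apply: (mulfI b_neq0).
    by apply/eqP; rewrite -subr_eq0 -E; apply/eqP; ring.
  apply: norm_form_anisotropic.
  (* The norm form depends on [X] only through [t], [d] and [e], all known by now. *)
  transitivity (t ^+ 2 * b + a ^+ 2 * d + e ^+ 2 - t * a * e - 4%:R * d * b).
    by rewrite /u /v /t /d /e; ring.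
  rewrite e_b d_b t_a.
  transitivity (b * (a ^+ 2 - 3%:R * b)); first by ring.
  by rewrite a2; ring.
have y_z : y = - b * z.
  by apply/eqP; rewrite -subr_eq0 -u0 /u; apply/eqP; ring.
have w_xz : w = x + a * z.
  by apply/eqP; rewrite -subr_eq0 -v0 /v; apply/eqP; ring.
(* [X (X - A) = P + Q A], where [X = x + z A]. *)
pose P := x ^+ 2 - b * (z * (z - 1)).
pose Q := x * (2%:R * z - 1) + a * (z * (z - 1)).
(* By [A^2 = a A - b], [X A (X - A) = A (P + Q A)] has coordinates [- b Q] and [P + a Q] on the
   identity and [A]; these are [E00] and [E10]. *)
have Q0 : Q = 0.
  apply: (mulfI b_neq0); apply: oppr_inj; rewrite mulr0 oppr0 -E00.
  by rewrite /Q /t /d /e y_z w_xz; ring.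
have P0 : P = 0.
  rewrite -[P](addrK (a * Q)) {2}Q0 mulr0 subr0 -E10.
  by rewrite /P /Q /d /e y_z w_xz; ring.
(* [n] is the norm of [X]. Multiplying [P + Q A = 0] by the conjugate [x + a z - z A] gives
   [n (X - A) = 0], whose coordinates are [nx] and [nz]. *)
pose n := x ^+ 2 + a * x * z + b * z ^+ 2.
have nx : n * x = 0.
  transitivity ((x + a * z) * P + b * z * Q); first by rewrite /n /P /Q; ring.
  by rewrite P0 Q0; ring.
have nz : n * (z - 1) = 0.
  transitivity (x * Q - z * P); first by rewrite /n /P /Q; ring.
  by rewrite P0 Q0; ring.
have [n0|n_neq0] := eqVneq n 0.
  have [x0 z0] := norm_form_anisotropic n0; left; apply: matrix2P.
  by rewrite !mxE -/x -/y -/z -/w y_z w_xz x0 z0 !mulr0 addr0.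
have x0 : x = 0 by apply: (mulfI n_neq0); rewrite mulr0.
have z1 : z = 1 by apply/eqP; rewrite -subr_eq0 -(mulrI_eq0 _ (mulfI n_neq0)) nz.
right; apply: matrix2P.
by rewrite !mxE /= -/x -/y -/z -/w y_z w_xz x0 z1 !mulr1 add0r.
Qed.

End AnisotropicNormForm.

Theorem theorem1p3 (F : finFieldType) (char_neq2 : 2%N \notin [pchar F])
    (a b : F) (irr : irreducible_poly ('X^2 - a *: 'X + b%:P))
    (hDelta : Delta a b = - b) :
  #|DA (A3 a b)| = 2%N.
Proof.
have -> : DA (A3 a b) = [set 0; A3 a b].
  apply/setP=> X; rewrite !inE; apply/eqP/orP.
    by case/(A3_braid_eq0_or_A3 irr hDelta) => ->; [left | right].
  by case=> /eqP-> //; rewrite !(mulmx0, mul0mx).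
rewrite cards2; suff -> : 0 != A3 a b by [].
apply/eqP=> /matrixP/(_ 1 0)/eqP.
by rewrite !mxE /= eq_sym oner_eq0.
Qed.
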